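(* Let $s\leqslant k\leqslant s+m$, and consider the explicit Euler scheme of $k$-HiSD $$\theta^{(t+1)}=\theta^{(t)}-\beta_t\Big(I-2\sum_{p=1}^k v_p^{(t)}v_p^{(t)\top}\Big)\nabla E(\theta^{(t)}),\qquad t=0,1,2,\dots,$$ where for every $t$ the vectors $\{v_p^{(t)}\}_{p=1}^k$ are orthonormal, $v_p^{(t)}=u_p^{(t)}$ for $1\leqslant p\leqslant s$, and $v_p^{(t)}\in U^{(t)}$ for $s+1\leqslant p\leqslant k$. If a fixed step size $\beta_t\equiv\beta$ with $0<\beta\leqslant 2/(L+\mu)$ is used for all $t\geqslant0$ and the initial point $\theta^{(0)}\in\mathcal{U}(\mathcal{M},\delta)$ satisfies $$r_0=\|\theta^{(0)}-\hat\theta^{(0)}\|_2<\hat r=\frac{2\mu^2\beta}{(5\mu\beta+4)M},$$ then $r_t=\|\theta^{(t)}-\hat\theta^{(t)}\|_2$ monotonically decreases and converges to $0$ as $t\to\infty$ with at least a linear convergence rate: $$r_t\leqslant(1+\mu\beta)^{-t}\,\frac{\hat r\,r_0}{\hat r-r_0}.$$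
   Context: Setting. $E:\mathbb{R}^d\to\mathbb{R}$ is a $\mathcal{C}^2$ function with bounded Hessian. $\mathcal{M}\subset\mathbb{R}^d$ is a closed, $\mathcal{C}^2$-embedded, connected, nondegenerate critical manifold of $E$ of dimension $m$ consisting of index-$s$ saddle points: every $\vartheta\in\mathcal{M}$ satisfies $\nabla E(\vartheta)=0$, $\nabla^2E(\vartheta)$ is nondegenerate on the normal space $N_\vartheta\mathcal{M}$ (equivalently $\operatorname{Ker}\nabla^2E(\vartheta)=T_\vartheta\mathcal{M}$), and $\nabla^2E(\vartheta)$ has exactly $s$ negative eigenvalues (counted with multiplicity). Notation. $\|\cdot\|_2$ is the Euclidean norm for vectors and the spectral norm for matrices. $\hat\theta=\mathcal{P}_{\mathcal{M}}(\theta)=\operatorname{arg\,min}_{\theta'\in\mathcal{M}}\|\theta-\theta'\|_2$ is the nearest-point projection, so $\|\theta-\hat\theta\|_2=\operatorname{dist}(\theta,\mathcal{M})$. The eigenvalues of $\nabla^2E(\theta)$ in ascending order are $\lambda_1\leqslant\dots\leqslant\lambda_d$, with corresponding orthonormal eigenvectors $u_1,\dots,u_d$. Standing assumption. There exist a $\delta$-tubular neighborhood $\mathcal{U}(\mathcal{M},\delta)=\{\theta\in\mathbb{R}^d:\|\theta-\hat\theta\|_2<\delta\}$ and constants $M,L,\mu>0$ with $M\delta\leqslant\mu/4$ such that: (i) $\mathcal{P}_{\mathcal{M}}$ is well defined on $\mathcal{U}(\mathcal{M},\delta)$; (ii) $\|\nabla^2E(\theta)-\nabla^2E(\theta')\|_2\leqslant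 M\|\theta-\theta'\|_2$ for all $\theta,\theta'\in\mathcal{U}(\mathcal{M},\delta)$; (iii) for all $\theta\in\mathcal{U}(\mathcal{M},\delta)$, $\lambda_1,\dots,\lambda_s\in[-L,-\mu]$ and $\lambda_{s+m+1},\dots,\lambda_d\in[\mu,L]$. For the iterates, $u_1^{(t)},\dots,u_d^{(t)}$ denote orthonormal eigenvectors of $\nabla^2E(\theta^{(t)})$ corresponding to its eigenvalues arranged in ascending order, and $U^{(t)}=\operatorname{span}\{u_p^{(t)}\}_{p=s+1}^{s+m}$. *)

(* Defs.v *)
From HB Require Import structures.
From mathcomp Require Import all_boot all_order all_algebra.
From mathcomp Require Import all_classical all_reals all_analysis.

Set Implicit Arguments.
Unset Strict Implicit.
Unset Printing Implicit Defensive.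

Import Order.TTheory GRing.Theory Num.Theory.
Import numFieldNormedType.Exports.

Local Open Scope classical_set_scope.
Local Open Scope ring_scope.

(* R^d is 'cV[R]_d.  The norm `|x| that the library puts on matrices is the
   sup norm; it induces the usual topology and the usual derivatives, but the
   Euclidean and spectral norms have to be defined separately. *)

Section Euclidean.
Variable R : realType.

Definition dotv d (x y : 'cV[R]_d) : R := \sum_(i < d) x i 0 * y i 0.

Definition norm2 d (x : 'cV[R]_d) : R := Num.sqrt (dotv x x).

Definition specnorm d (A : 'M[R]_d) : R :=
  sup [set norm2 (A *m x) | x in [set x : 'cV[R]_d | norm2 x <= 1]].

Definition orthonormal_family (I : eqType) d (u : I -> 'cV[R]_d) : Prop :=
  forall i j : I, dotv (u i) (u j) = (i == j)%:R.

Definition is_nearest d (S : set 'cV[R]_d) (x p : 'cV[R]_d) : Prop :=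
  S p /\ forall q, S q -> norm2 (x - p) <= norm2 (x - q).

(* A nearest point of S to x; it is meaningful when there is exactly one. *)
Definition nearest_proj d (S : set 'cV[R]_d) (x : 'cV[R]_d) : 'cV[R]_d :=
  xget 0 (is_nearest S x).

Definition tube d (S : set 'cV[R]_d) (delta : R) : set 'cV[R]_d :=
  [set x | norm2 (x - nearest_proj S x) < delta].

End Euclidean.

Section Eigenvalues.
Variable R : realType.

(* The eigenvalues of A, repeated with algebraic multiplicity, in ascending
   order: entry i (counted from 0) is lambda_{i+1}.  They exist and are unique
   as soon as char_poly A splits over R, hence for every symmetric A; otherwise
   the value is the junk value 0. *)
Definition eigvals d (A : 'M[R]_d) : 'rV[R]_d :=
  xget 0 [set l : 'rV[R]_d |
    (forall i j : 'I_d, (i <= j)%N -> l 0 i <= l 0 j) /\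
    char_poly A = \prod_(i < d) ('X - (l 0 i)%:P)].

Definition ordered_eigenbasis d (A : 'M[R]_d) (u : 'I_d -> 'cV[R]_d) : Prop :=
  orthonormal_family u /\ forall i, A *m u i = eigvals A 0 i *: u i.

Definition morse_index d (A : 'M[R]_d) : nat := #|[set i | eigvals A 0 i < 0]%SET|.

End Eigenvalues.

Section Calculus.
Variable R : realType.

Definition partial d (V : normedModType R) (i : 'I_d) (f : 'cV[R]_d -> V)
    (x : 'cV[R]_d) : V :=
  'D_(delta_mx i 0) f x.

(* Continuous differentiability on an open set, through the existence and
   continuity of the partial derivatives. *)
Definition C1_on d (V : normedModType R) (U : set 'cV[R]_d)
    (f : 'cV[R]_d -> V) : Prop :=
  forall x, U x -> forall i : 'I_d,
    derivable f x (delta_mx i 0) /\ {for x, continuous (partial i f)}.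

Definition C2_on d (V : normedModType R) (U : set 'cV[R]_d)
    (f : 'cV[R]_d -> V) : Prop :=
  C1_on U f /\ forall i : 'I_d, C1_on U (partial i f).

Definition grad d (E : 'cV[R]_d -> R) (x : 'cV[R]_d) : 'cV[R]_d :=
  \col_i partial i (E : _ -> R^o) x.

Definition hess d (E : 'cV[R]_d -> R) (x : 'cV[R]_d) : 'M[R]_d :=
  \matrix_(i, j) partial j (partial i (E : _ -> R^o)) x.

End Calculus.

Section Manifolds.
Variable R : realType.

(* C^2 embedded submanifold of dimension m: around each of its points there is
   a C^2 diffeomorphism phi between open sets of R^d, with inverse psi, that
   straightens S to R^m x {0}. *)
Definition C2_submanifold d (m : nat) (S : set 'cV[R]_d) : Prop :=
  (m <= d)%N /\
  forall p, S p -> exists (U V : set 'cV[R]_d) (phi psi : 'cV[R]_d -> 'cV[R]_d),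
    [/\ open U, open V, U p, C2_on U phi & C2_on V psi] /\
    [/\ forall x, U x -> V (phi x) /\ psi (phi x) = x,
        forall y, V y -> U (psi y) /\ phi (psi y) = y &
        forall x, U x ->
          (S x <-> forall i : 'I_d, (m <= i)%N -> phi x i 0 = 0)].

(* Velocities at p of the C^1 curves drawn on S. *)
Definition tangent_space d (S : set 'cV[R]_d) (p : 'cV[R]_d) : set 'cV[R]_d :=
  [set v | exists (gamma : R -> 'cV[R]_d) (eps : R),
    [/\ 0 < eps, gamma 0 = p, derive1 gamma 0 = v &
        forall t, `|t| < eps ->
          [/\ S (gamma t), derivable gamma t 1 &
              {for t, continuous (derive1 gamma)}]]].

Definition normal_space d (S : set 'cV[R]_d) (p : 'cV[R]_d) : set 'cV[R]_d :=
  [set w | forall v, tangent_space S p v -> dotv v w = 0].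

Definition nondegenerate_on d (N : set 'cV[R]_d) (A : 'M[R]_d) : Prop :=
  forall w, N w -> (forall w', N w' -> dotv w' (A *m w) = 0) -> w = 0.

Definition nondegenerate_critical_manifold d (E : 'cV[R]_d -> R)
    (S : set 'cV[R]_d) (m s : nat) : Prop :=
  [/\ closed S, connected S, C2_submanifold m S &
      forall p, S p ->
        [/\ grad E p = 0,
            nondegenerate_on (normal_space S p) (hess E p) &
            morse_index (hess E p) = s]].

End Manifolds.

(* Main.v *)
Require Import Defs.
From HB Require Import structures.
From mathcomp Require Import all_boot all_order all_algebra.
From mathcomp Require Import all_classical all_reals all_analysis.
From mathcomp Require Import ring lra zify.

Set Implicit Arguments.
Unset Strict Implicit.
Unset Printing Implicit Defensive.

Import Order.TTheory GRing.Theory Num.Theory.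
Import numFieldNormedType.Exports.

Local Open Scope classical_set_scope.
Local Open Scope ring_scope.

(* Write z = theta - p with p the projection of theta on the manifold, r = |z|,
   H = hess E theta.  The tangent space K at p has dimension at least m, is
   killed by hess E p and is orthogonal to z.  By the Lipschitz bound
   |H w| <= M r |w| on K, so K is close to the span of the m middle
   eigenvectors of H, the other eigenvalues being at least mu in absolute value;
   hence the middle component y of z satisfies |y| <= 4/3 M r^2 / mu and
   |H y| <= 4/3 M r |y|.  On the outer eigenvectors the reflected Hessian acts
   as |H|, so one Euler step contracts the outer component by 1 - mu beta, and
   altogether r' <= (1 - mu beta) r + (2 / mu + 5 beta / 2) M r^2
   = r - mu beta r (1 - r / rhat).  Then r / (rhat - r) shrinks by the factor
   1 / (1 + mu beta) at each step. *)

(** * Euclidean norm and orthonormal bases *)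

Section EuclideanTheory.
Context {R : realType} {d : nat}.
Implicit Types (x y z : 'cV[R]_d) (a : R) (A : 'M[R]_d).

Lemma dotv_mulmx x y : dotv x y = (x^T *m y) 0 0.
Proof. by rewrite mxE; apply: eq_bigr => i _; rewrite mxE. Qed.

Lemma dotvC x y : dotv x y = dotv y x.
Proof. by apply: eq_bigr => i _; rewrite mulrC. Qed.

Lemma dotvDr x y z : dotv x (y + z) = dotv x y + dotv x z.
Proof. by rewrite !dotv_mulmx mulmxDr mxE. Qed.

Lemma dotvZr a x y : dotv x (a *: y) = a * dotv x y.
Proof. by rewrite !dotv_mulmx -scalemxAr mxE. Qed.

Lemma dotvNr x y : dotv x (- y) = - dotv x y.
Proof. by rewrite -scaleN1r dotvZr mulN1r. Qed.

Lemma dotvBr x y z : dotv x (y - z) = dotv x y - dotv x z.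
Proof. by rewrite dotvDr dotvNr. Qed.

Lemma dotvDl x y z : dotv (y + z) x = dotv y x + dotv z x.
Proof. by rewrite !(dotvC _ x) dotvDr. Qed.

Lemma dotvZl a x y : dotv (a *: y) x = a * dotv y x.
Proof. by rewrite !(dotvC _ x) dotvZr. Qed.

Lemma dotvNl x y : dotv (- y) x = - dotv y x.
Proof. by rewrite !(dotvC _ x) dotvNr. Qed.

Lemma dotvBl x y z : dotv (y - z) x = dotv y x - dotv z x.
Proof. by rewrite !(dotvC _ x) dotvBr. Qed.

Lemma dotv0 x : dotv x 0 = 0.
Proof. by rewrite -(scale0r x) dotvZr mul0r. Qed.

Lemma dotv_sumr (I : Type) (r : seq I) (P : pred I) (F : I -> 'cV[R]_d) x :
  dotv x (\sum_(i <- r | P i) F i) = \sum_(i <- r | P i) dotv x (F i).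
Proof.
elim/big_ind2: _ => [|a b y z <- <-|//]; first exact: dotv0.
exact: dotvDr.
Qed.

Lemma dotvv_ge0 x : 0 <= dotv x x.
Proof. by apply: sumr_ge0 => i _; rewrite -expr2 sqr_ge0. Qed.

Lemma dotvv_eq0 x : dotv x x = 0 -> x = 0.
Proof.
move=> /eqP; rewrite psumr_eq0; last by move=> i _; rewrite -expr2 sqr_ge0.
move=> /allP x0; apply/colP => i; rewrite mxE.
by have := x0 i (mem_index_enum i); rewrite /= -expr2 sqrf_eq0 => /eqP.
Qed.

Lemma norm2_ge0 x : 0 <= norm2 x.
Proof. exact: sqrtr_ge0. Qed.

Lemma norm2_sqr x : norm2 x ^+ 2 = dotv x x.
Proof. by rewrite sqr_sqrtr// dotvv_ge0. Qed.

Lemma norm2_eq0 x : norm2 x = 0 -> x = 0.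
Proof. by move=> x0; apply: dotvv_eq0; rewrite -norm2_sqr x0 expr0n. Qed.

Lemma norm20 : norm2 (0 : 'cV[R]_d) = 0.
Proof. by rewrite /norm2 dotv0 sqrtr0. Qed.

Lemma norm2Z a x : norm2 (a *: x) = `|a| * norm2 x.
Proof. by rewrite /norm2 dotvZl dotvZr mulrA -expr2 sqrtrM ?sqr_ge0// sqrtr_sqr. Qed.

Lemma norm2N x : norm2 (- x) = norm2 x.
Proof. by rewrite -scaleN1r norm2Z normrN1 mul1r. Qed.

Lemma dotv_le x y : dotv x y <= norm2 x * norm2 y.
Proof.
have [y0|y0] := eqVneq (norm2 y) 0.
  by rewrite (norm2_eq0 y0) dotv0 norm20 mulr0.
have ypos : 0 < norm2 y by rewrite lt_def y0 norm2_ge0.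
have : 0 <= dotv (norm2 y ^+ 2 *: x - dotv x y *: y)
                 (norm2 y ^+ 2 *: x - dotv x y *: y) by exact: dotvv_ge0.
rewrite !dotvBl !dotvBr !dotvZl !dotvZr (dotvC y x) -!norm2_sqr => h.
have {}h : 0 <= norm2 y ^+ 2 * ((norm2 x * norm2 y) ^+ 2 - dotv x y ^+ 2) by nra.
move: h; rewrite pmulr_rge0 ?exprn_gt0// subr_ge0 => h.
apply: le_trans (ler_norm _) _.
by rewrite -(@ler_pXn2r _ 2) ?nnegrE ?mulr_ge0 ?norm2_ge0// real_normK ?num_real.
Qed.

Lemma norm2D x y : norm2 (x + y) <= norm2 x + norm2 y.
Proof.
rewrite -(@ler_pXn2r _ 2) ?nnegrE ?addr_ge0 ?norm2_ge0//.
rewrite norm2_sqr dotvDl !dotvDr (dotvC y x) sqrrD !norm2_sqr.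
by have := dotv_le x y; lra.
Qed.

(** The [sup] in [specnorm] dominates its set only if that set is bounded; Cauchy-Schwarz on each
    row gives the Frobenius norm as a bound. *)
Lemma norm2_mulmx_bounded A :
  exists C, forall x, norm2 x <= 1 -> norm2 (A *m x) <= C.
Proof.
exists (Num.sqrt (\sum_i dotv (row i A)^T (row i A)^T)) => x x1.
rewrite /norm2 ler_sqrt; last by apply: sumr_ge0 => i _; exact: dotvv_ge0.
apply: ler_sum => i _.
have -> : (A *m x) i 0 = dotv (row i A)^T x.
  by rewrite dotv_mulmx trmxK -row_mul !mxE.
rewrite -expr2 -norm2_sqr -real_normK ?num_real// ler_pXn2r ?nnegrE ?norm2_ge0//.
have rx : forall y, dotv y x <= norm2 y.
  by move=> y; apply: le_trans (dotv_le _ _) _; rewrite ler_piMr ?norm2_ge0.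
by rewrite ler_norml rx lerNl -dotvNl (le_trans (rx _))// norm2N.
Qed.

Lemma norm2_mulmx_le A x : norm2 (A *m x) <= specnorm A * norm2 x.
Proof.
have [x0|x0] := eqVneq (norm2 x) 0.
  by rewrite (norm2_eq0 x0) mulmx0 norm20 mulr0.
have xpos : 0 < norm2 x by rewrite lt_def x0 norm2_ge0.
rewrite -ler_pdivrMr//.
have -> : norm2 (A *m x) / norm2 x = norm2 (A *m ((norm2 x)^-1 *: x)).
  by rewrite -scalemxAr norm2Z ger0_norm ?invr_ge0 ?norm2_ge0// mulrC.
apply: ub_le_sup.
  by have [C AC] := norm2_mulmx_bounded A; exists C => _ [y /= /AC + <-].
by exists ((norm2 x)^-1 *: x) => //=;
  rewrite norm2Z ger0_norm ?invr_ge0 ?norm2_ge0// mulVf.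
Qed.

End EuclideanTheory.

Section OrthonormalBasis.
Context {R : realType} {d : nat} (u : 'I_d -> 'cV[R]_d).
Hypothesis u_orth : orthonormal_family u.
Implicit Types (x y : 'cV[R]_d) (P : pred 'I_d).

(** The matrix with columns [u j] is square, so its left inverse [U^T] is also a right inverse: [d]
    orthonormal vectors form a basis. *)
Lemma orthonormal_expand x : x = \sum_i dotv (u i) x *: u i.
Proof.
pose U : 'M[R]_d := \matrix_(i, j) u j i 0.
have UTU : U^T *m U = 1%:M.
  apply/matrixP => i j; rewrite !mxE -u_orth.
  by apply: eq_bigr => l _; rewrite !mxE.
rewrite -[LHS]mul1mx -(mulmx1C UTU) -mulmxA.
apply/colP => i; rewrite mxE summxE; apply: eq_bigr => j _.
by rewrite !mxE mulrC; congr (_ * _); apply: eq_bigr => l _; rewrite !mxE.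
Qed.

Lemma dotv_coord x y : dotv x y = \sum_i dotv (u i) x * dotv (u i) y.
Proof.
rewrite {1}(orthonormal_expand y) dotv_sumr.
by apply: eq_bigr => i _; rewrite dotvZr mulrC (dotvC x).
Qed.

Lemma norm2_le_coord (c : R) x y : 0 <= c ->
  (forall i, `|dotv (u i) x| <= c * `|dotv (u i) y|) -> norm2 x <= c * norm2 y.
Proof.
move=> c0 xy; rewrite -(@ler_pXn2r _ 2) ?nnegrE ?mulr_ge0 ?norm2_ge0//.
rewrite exprMn !norm2_sqr !dotv_coord mulr_sumr; apply: ler_sum => i _.
rewrite -!expr2 -real_normK ?num_real// -[dotv _ y ^+ 2]real_normK ?num_real//.
by rewrite -exprMn ler_pXn2r ?nnegrE ?mulr_ge0.
Qed.

Lemma dotv_comb P (c : 'I_d -> R) i :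
  dotv (u i) (\sum_(j | P j) c j *: u j) = if P i then c i else 0.
Proof.
rewrite dotv_sumr; case: ifP => Pi.
  rewrite (bigD1 i)//= dotvZr u_orth eqxx mulr1 big1 ?addr0// => j /andP[_ ji].
  by rewrite dotvZr u_orth eq_sym (negbTE ji) mulr0.
rewrite big1// => j Pj; rewrite dotvZr u_orth.
by case: eqP Pj => [<-|_ _]; [rewrite Pi|rewrite mulr0].
Qed.

Definition coord_proj P x : 'cV[R]_d := \sum_(i | P i) dotv (u i) x *: u i.

Lemma dotv_coord_proj P x i :
  dotv (u i) (coord_proj P x) = if P i then dotv (u i) x else 0.
Proof. exact: dotv_comb. Qed.

Lemma coord_projC P x : coord_proj P x + coord_proj (predC P) x = x.
Proof. by rewrite [RHS]orthonormal_expand [RHS](bigID P). Qed.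

Lemma norm2_coord_proj P x : norm2 (coord_proj P x) <= norm2 x.
Proof.
rewrite -[leRHS]mul1r; apply: norm2_le_coord => // i; rewrite dotv_coord_proj.
by case: ifP => _; rewrite mul1r ?lexx// normr0.
Qed.

End OrthonormalBasis.

(** * Functions with continuous partial derivatives *)

Lemma is_derive_line {R : realType} (V W : normedModType R) (f : V -> W) b v (t : R) :
  derivable f (b + t *: v) v ->
  is_derive t 1 (fun s : R => f (b + s *: v)) ('D_v f (b + t *: v)).
Proof.
have E : (fun h : R => h^-1 *: (((fun s : R => f (b + s *: v)) \o shift t) (h *: (1 : R^o))
            - f (b + t *: v))) =
         (fun h : R => h^-1 *: ((f \o shift (b + t *: v)) (h *: v) - f (b + t *: v))).
  apply/funext => h /=; congr (_ *: (f _ - _)).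
  by rewrite [h%:A]mulr1 scalerDl addrCA.
by move=> fv; apply: DeriveDef; rewrite /derivable /derive E.
Qed.

Lemma differentiable_of_approx {R : realType} (V W : normedModType R) (f : V -> W)
    (L : {linear V -> W}) a : continuous L ->
  (forall e : R, 0 < e ->
    \forall h \near (0 : V), `|f (a + h) - f a - L h| <= e * `|h|) ->
  differentiable f a.
Proof.
move=> Lc fL; have fE : f \o shift a = cst (f a) + L +o_ 0 id.
  apply/eqaddoP => _/posnumP[e].
  near=> h.
  rewrite -[(_ - (_ + _)) h]/(f (h + a) - (f a + L h)) opprD addrA [h + a]addrC.
  by near: h; apply: fL.
by apply/diff_locallyP; rewrite (diff_unique Lc fE).
Unshelve. all: by end_near. Qed.

Section Calculus.
Context {R : realType} {d : nat}.
Implicit Types (f : 'cV[R]_d -> R^o) (a b v h x : 'cV[R]_d).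


(** Writing the intermediate point with [c * T] lets one statement cover all signs of [T]; for
    negative [T] the segment is run from its other end, which turns [c] into [1 - c]. *)
Lemma MVT_line f b v (T : R) :
  (forall c, 0 <= c <= 1 -> derivable f (b + (c * T) *: v) v) ->
  exists2 c, 0 <= c <= 1 & f (b + T *: v) - f b = T * 'D_v f (b + (c * T) *: v).
Proof.
wlog T0 : b T / 0 <= T => [wl fv|fv].
  have [T0|T0] := leP 0 T; first exact: wl.
  have bE c : b + T *: v + (c * - T) *: v = b + ((1 - c) * T) *: v.
    by rewrite -addrA -scalerDl; congr (_ + _ *: _); ring.
  have [||c c01] := wl (b + T *: v) (- T).
  - by rewrite oppr_ge0 ltW.
  - by move=> c c01; rewrite bE; apply: fv; lra.
  rewrite bE -addrA -scalerDl subrr scale0r addr0 => /eqP.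
  rewrite -eqr_opp opprB mulNr opprK => /eqP E.
  by exists (1 - c) => //; lra.
have [T1|T1] := eqVneq T 0.
  by exists 0; rewrite ?lexx ?ler01// T1 scale0r addr0 subrr mul0r.
have {T1 T0}T0 : 0 < T by rewrite lt_def T1.
have fv' t : 0 <= t <= T -> derivable f (b + t *: v) v.
  move=> /andP[t0 tT]; rewrite -(divfK (lt0r_neq0 T0) t); apply: fv.
  by rewrite divr_ge0 ?(ltW T0)//= ler_pdivrMr// mul1r.
have [|| c cT] := @MVT _ (fun s => f (b + s *: v)) (fun s => 'D_v f (b + s *: v)) 0 T T0.
- move=> t; rewrite in_itv /= => /andP[t0 tT].
  by apply: is_derive_line; apply: fv'; rewrite !ltW.
- apply: derivable_within_continuous => t; rewrite in_itv /= => tT.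
  by have [] := is_derive_line (fv' _ tT).
rewrite scale0r addr0 subr0 mulrC => ->.
move: cT; rewrite in_itv /= => /andP[c0 cT].
exists (c / T); last by rewrite divfK// lt0r_neq0.
by rewrite divr_ge0 ?(ltW c0) ?(ltW T0)//= ler_pdivrMr// mul1r ltW.
Qed.

Lemma cV_norm_le x (e : R) : 0 <= e -> (forall i, `|x i 0| <= e) -> `|x| <= e.
Proof.
move=> e0 xe; rewrite [leLHS]/Num.norm /= mx_normrE bigmax_le//= => -[i j] _ /=.
by rewrite ord1.
Qed.

Lemma cV_le_norm x i : `|x i 0| <= `|x|.
Proof.
rewrite [leRHS]/Num.norm /= mx_normrE.
exact: (le_bigmax _ (fun ij : 'I_d * 'I_1 => `|x ij.1 ij.2|) (i, 0)).
Qed.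

Lemma cV_basis x : x = \sum_i x i 0 *: delta_mx i 0.
Proof.
apply/colP => i; rewrite summxE (bigD1 i)//= !mxE !eqxx mulr1 big1 ?addr0//.
by move=> j ji; rewrite !mxE eq_sym (negbTE ji) mulr0.
Qed.

Lemma continuous_coord_form (c : 'I_d -> R) :
  continuous (fun h : 'cV[R]_d => \sum_i h i 0 * c i).
Proof.
apply: continuous_big => [|i _ x]; first exact: add_continuous.
apply: (@cvgM _ _ (nbhs x) _ (fun h : 'cV[R]_d => h i 0) (cst (c i))).
  exact: coord_continuous.
exact: cvg_cst.
Qed.

Let lin f a h : R^o := \sum_i h i 0 * partial i f a.

Let lin_is_linear f a : linear (lin f a).
Proof.
move=> c x y; rewrite /lin scaler_sumr -big_split/=; apply: eq_bigr => i _.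
by rewrite !mxE mulrDl -mulrA.
Qed.

Let lin_continuous f a : continuous (lin f a).
Proof.
exact: continuous_coord_form.
Qed.

(* Moves from [a] to [a + h] one coordinate at a time. *)
Let lin_approx (U : set 'cV[R]_d) f a : open U -> C1_on U f -> U a ->
  forall e : R, 0 < e ->
  \forall h \near (0 : 'cV[R]_d), `|f (a + h) - f a - lin f a h| <= e * `|h|.
Proof.
move=> Uo fC1 Ua e e0.
(* Each of the [d] coordinate moves contributes at most [e1] times the norm of [h]; [d.+1] keeps the
   denominator nonzero for [d = 0]. *)
pose e1 := e / d.+1%:R.
have e10 : 0 < e1 by rewrite divr_gt0.
have near_partial : \forall x \near a, forall i, `|partial i f a - partial i f x| <= e1.
  pose F (i : 'I_d) := [set x | `|partial i f a - partial i f x| <= e1].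
  apply: (@filter_forall _ _ F _ (nbhs_filter a)) => i; have [_ /cvgrPdist_le/(_ _ e10)] := fC1 a Ua i.
  exact.
have /nbhs_ballP[r /= r0] := @filterI _ _ (nbhs_filter a) _ _
  (open_nbhs_nbhs (conj Uo Ua)) near_partial.
rewrite -ball_normE => Br.
have : \forall h \near (0 : 'cV[R]_d), `|h| < r by exact: nbhs0_lt.
apply: filterS => h hr.
(* [p k] keeps the first [k] coordinates of [h]. In the sup norm no intermediate point is farther
   from [a] than [a + h], so all of them lie in the ball where the partial derivatives are close to
   those at [a]. *)
pose p (k : nat) : 'cV[R]_d := \col_j (if (j < k)%N then h j 0 else 0).
have p_in (k : 'I_d) (c : R) : 0 <= c <= 1 ->
    `|p k + (c * h k 0) *: delta_mx k 0| <= `|h|.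
  move=> /andP[c0 c1]; apply: cV_norm_le => // j; rewrite !mxE.
  rewrite eqxx andbT; have [->|_] /= := eqVneq j k.
    by rewrite ltnn add0r mulr1 normrM ger0_norm// (le_trans _ (cV_le_norm h k))// ler_piMl.
  rewrite mulr0 addr0; case: ifP => _; [exact: cV_le_norm|by rewrite normr0].
have Br' (k : 'I_d) (c : R) : 0 <= c <= 1 ->
    U (a + p k + (c * h k 0) *: delta_mx k 0) /\
    forall i, `|partial i f a - partial i f (a + p k + (c * h k 0) *: delta_mx k 0)| <= e1.
  move=> c01; apply: Br => /=.
  by rewrite -addrA opprD addNKr normrN (le_lt_trans (p_in k c c01)).
have step (k : 'I_d) : `|f (a + p k.+1) - f (a + p k) - h k 0 * partial k f a| <= e1 * `|h|.
  have -> : a + p k.+1 = a + p k + h k 0 *: delta_mx k 0.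
    rewrite -addrA; congr (_ + _); apply/colP => j; rewrite !mxE eqxx andbT.
    have [->|jk] := eqVneq j k; first by rewrite ltnS leqnn ltnn add0r mulr1.
    rewrite mulr0 addr0 ltnS leq_eqVlt.
    by move/negbTE: jk; rewrite -val_eqE /= => ->.
  have [c c01|c c01 ->] := @MVT_line f (a + p k) (delta_mx k 0) (h k 0).
    by have [/fC1/(_ k)[]] := Br' k c c01.
  rewrite -mulrBr normrM mulrC ler_pM//; last exact: cV_le_norm.
  by rewrite distrC; have [_] := Br' k c c01; apply.
have -> : f (a + h) - f a - lin f a h =
    \sum_(k < d) (f (a + p k.+1) - f (a + p k) - h k 0 * partial k f a).
  rewrite big_split/= sumrN; congr (_ - _).
  rewrite -(big_mkord predT (fun k => f (a + p k.+1) - f (a + p k))).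
  rewrite telescope_sumr//; congr (f (a + _) - f _).
    by apply/colP => j; rewrite mxE ltn_ord.
  by rewrite (_ : p 0 = 0) ?addr0//; apply/colP => j; rewrite !mxE.
apply: le_trans (ler_norm_sum _ _ _) _.
apply: (@le_trans _ _ (\sum_(k < d) e1 * `|h|)); first exact: ler_sum.
rewrite sumr_const card_ord -mulrnAl ler_wpM2r// -mulr_natr /e1 mulrAC.
by rewrite ler_pdivrMr// ler_wpM2l ?(ltW e0)// ler_nat.
Qed.

(** Upgrades continuous partial derivatives to full differentiability, which the chain rule along
    curves requires. *)
Lemma C1_differentiable (U : set 'cV[R]_d) f a :
  open U -> C1_on U f -> U a -> differentiable f a.
Proof.
move=> Uo fC1 Ua.
pose linM := GRing.isLinear.Build _ _ _ _ _ (@lin_is_linear f a).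
pose L : {linear 'cV[R]_d -> R^o} := HB.pack (lin f a) linM.
apply: (@differentiable_of_approx _ _ _ f L); first exact: lin_continuous.
exact: lin_approx Uo fC1 Ua.
Qed.

Lemma derive_partial f a v : differentiable f a ->
  'D_v f a = \sum_i v i 0 * partial i f a.
Proof.
move=> fa; rewrite deriveE// [in LHS](cV_basis v) linear_sum; apply: eq_bigr => i _.
by rewrite linearZ /= /partial deriveE.
Qed.

Lemma derive_curve f (g : R -> 'cV[R]_d) (t : R) :
  derivable g t 1 -> differentiable f (g t) ->
  is_derive t 1 (f \o g) (\sum_i derive1 g t i 0 * partial i f (g t)).
Proof.
move=> /derivable1_diffP dg df.
have dfg : differentiable (f \o g) t by exact: differentiable_comp.
apply: DeriveDef; first exact: diff_derivable.
by rewrite deriveE// diff_comp//= derive1E' // -deriveE// derive_partial.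
Qed.

End Calculus.

(** * Tangent vectors and nearest points *)

Section Geometry.
Context {R : realType} {d : nat}.
Implicit Types (S : set 'cV[R]_d) (x p v : 'cV[R]_d).

Lemma cvg_line x v (t : R) : x + s *: v @[s --> t] --> x + t *: v.
Proof.
apply: cvgD; first exact: cvg_cst.
by apply: cvgZr_tmp; exact: cvg_id.
Qed.

Lemma continuous_dotv_sub x : continuous (fun y : 'cV[R]_d => dotv (x - y) (x - y)).
Proof.
apply: continuous_big => [|i _ y]; first exact: add_continuous.
have sc : {for y, continuous (fun y : 'cV[R]_d => (x - y) i 0)}.
  rewrite (_ : (fun _ => _) = (fun y : 'cV[R]_d => x i 0 - y i 0)).
    2: by apply/funext => z; rewrite !mxE.
  apply: (@cvgB _ _ _ (nbhs y) _ (cst (x i 0)) (fun z : 'cV[R]_d => z i 0)).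
    exact: cvg_cst.
  exact: coord_continuous.
exact: (@cvgM _ _ (nbhs y) _ _ _ _ _ sc sc).
Qed.

Lemma coord_le_norm2 x i : `|x i 0| <= norm2 x.
Proof.
rewrite -(@ler_pXn2r _ 2) ?nnegrE ?norm2_ge0// norm2_sqr real_normK ?num_real//.
rewrite /dotv (bigD1 i)//= expr2 lerDl sumr_ge0// => j _.
by rewrite -expr2 sqr_ge0.
Qed.

(** Minimizes the squared distance over the points of [S] no farther from [x] than [q0], a compact
    set; points are transposed to row vectors to apply [bounded_closed_compact]. Hence
    [nearest_proj] does not fall back on its default value, inside or outside the tube. *)
Lemma nearest_exists S x : closed S -> S !=set0 -> exists p, is_nearest S x p.
Proof.
move=> Sc [q0 Sq0].
pose K := [set w : 'rV[R]_d | S w^T /\ norm2 (x - w^T) <= norm2 (x - q0)].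
pose f (w : 'rV[R]_d) := dotv (x - w^T) (x - w^T).
have trc : continuous (fun w : 'rV[R]_d => w^T).
  move=> w A [P wP PA]; exists (fun i j => P j i) => [i j|M MP /=].
    by have := wP j i; rewrite mxE.
  by apply: PA => i j; rewrite mxE; exact: MP.
have fc : continuous f.
  move=> w; exact: (@continuous_comp _ _ _ (fun w : 'rV[R]_d => w^T)
    (fun y => dotv (x - y) (x - y)) w (trc w) (@continuous_dotv_sub x (w^T))).
have KE : K = ((fun w : 'rV[R]_d => w^T) @^-1` S) `&` (f @^-1` [set y | y <= dotv (x - q0) (x - q0)]).
  apply/seteqP; split=> w [Sw /= wq]; split => //=.
    by rewrite /f -!norm2_sqr ler_pXn2r ?nnegrE ?norm2_ge0.
  by rewrite -(@ler_pXn2r _ 2) ?nnegrE ?norm2_ge0// !norm2_sqr.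
have Kc : closed K.
  rewrite KE; apply: closedI.
    by apply: preimage_closed Sc => w _; exact: trc.
  by apply: preimage_closed (@closed_le _ _) => w _; exact: fc.
have Kb : bounded_set K.
  exists (`|x| + norm2 (x - q0)); split; first exact: num_real.
  move=> C /ltW Cx w [_ wq] /=.
  apply: le_trans Cx; rewrite [leLHS]/Num.norm /= mx_normrE.
  apply: bigmax_le => [|[i j] _ /=]; first by rewrite addr_ge0 ?norm2_ge0.
  have -> : w i j = x j 0 - (x - w^T) j 0 by rewrite !mxE subKr (ord1 i).
  apply: le_trans (ler_normB _ _) _; apply: lerD; first exact: cV_le_norm.
  exact: le_trans (coord_le_norm2 _ _) wq.
have K0 : K !=set0 by exists q0^T; split; rewrite trmxK.
have [w /set_mem[Sw wq] wmin] :=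
  compact_EVT_min K0 (bounded_closed_compact Kb Kc) (continuous_subspaceT fc).
exists w^T; split=> // q Sq.
have [qq0|/ltW qq0] := leP (norm2 (x - q)) (norm2 (x - q0)); last exact: le_trans qq0.
have /wmin : q^T \in K by apply/mem_set; split; rewrite trmxK.
by rewrite /f trmxK -!norm2_sqr ler_pXn2r ?nnegrE ?norm2_ge0.
Qed.

(** Along a curve drawn on [S] through [p], the squared distance to [x] is minimal at time 0, where
    its derivative is [-2 * dotv v (x - p)]. *)
Lemma tangent_orthogonal S x p v :
  is_nearest S x p -> tangent_space S p v -> dotv v (x - p) = 0.
Proof.
move=> [Sp pmin] [g [eps [eps0 g0 gv gS]]].
pose q (i : 'I_d) (t : R) : R := x i 0 - g t i 0.
have dq (i : 'I_d) (t : R) : `|t| < eps -> is_derive t 1 (q i) (- derive1 g t i 0).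
  move=> /gS[_ gt _]; have gti := (derivable_mxP _ _ _).1 gt i 0.
  rewrite derive1E (derive_mx gt) mxE -[X in is_derive _ _ _ X]add0r.
  by apply: is_deriveD; apply: is_deriveN; apply: derivableP.
pose f := \sum_i (q i ^+ 2).
have df (t : R) : `|t| < eps -> is_derive t 1 f (\sum_i (2 * q i t * - derive1 g t i 0)).
  move=> te; apply: is_derive_sum => i; have dqi := dq i t te.
  apply: is_derive_eq. by rewrite /= expr1.
have fE t : f t = dotv (x - g t) (x - g t).
  by rewrite /f fct_sumE; apply: eq_bigr => i _; rewrite !fctE !mxE.
have []:= @derive1_at_min _ f (- eps) eps 0.
- by lra.
- by move=> t; rewrite in_itv /= -ltr_norml => /df[].
- by rewrite in_itv /=; lra.
- move=> t; rewrite in_itv /= -ltr_norml => /gS[St _ _].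
  by rewrite !fE g0 -!norm2_sqr ler_pXn2r ?nnegrE ?norm2_ge0// pmin.
move=> _; have -> := @derive_val _ _ _ _ _ _ _ (df 0 _); last by rewrite normr0.
move=> f0; apply: (@mulfI _ (-2)) => //; rewrite mulr0 -f0 mulr_sumr.
by apply: eq_bigr => i _; rewrite /q g0 gv !mxE; ring.
Qed.

(** The gradient vanishes identically along a curve on [S]; differentiating its component [i] at
    time 0 gives entry [i] of [hess E p *m v]. *)
Lemma hess_tangent (E : 'cV[R]_d -> R) S p v :
  C2_on setT (E : _ -> R^o) -> (forall q, S q -> grad E q = 0) ->
  tangent_space S p v -> hess E p *m v = 0.
Proof.
move=> [_ E2] gE [g [eps [eps0 g0 gv gS]]].
apply/colP => i; rewrite mxE [RHS]mxE.
have [_ dg _] : [/\ S (g 0), derivable g 0 1 & {for 0, continuous (derive1 g)}].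
  by apply: gS; rewrite normr0.
have dp : differentiable (partial i (E : _ -> R^o)) (g 0).
  by apply: (C1_differentiable openT (E2 i)).
have := derive_curve dg dp.
have z : \forall t \near (0 : R), (partial i (E : _ -> R^o) \o g) t = cst 0 t.
  have : \forall t \near (0 : R), `|t| < eps by exact: nbhs0_lt.
  apply: filterS => t /gS[/gE /colP/(_ i)]/=; rewrite !mxE.
  by [].
move/@derive_val; rewrite (near_eq_derive _ z).
rewrite derive_cst => z'; apply: etrans (esym z'); apply: eq_bigr => j _.
by rewrite g0 gv mxE mulrC.
Qed.

Lemma C1_on_coord (U : set 'cV[R]_d) n (f : 'cV[R]_d -> 'cV[R]_n) l :
  open U -> C1_on U f -> C1_on U (fun x => f x l 0 : R^o).
Proof.
move=> Uo fC1 x Ux i; have [fx fc] := fC1 x Ux i; split.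
  exact: (derivable_mxP _ _ _).1 fx l 0.
have E : \forall y \near x, partial i f y l 0 = partial i (fun x => f x l 0 : R^o) y.
  have : nbhs x U by exact: open_nbhs_nbhs.
  apply: filterS => y /fC1/(_ i)[fy _].
  by rewrite /partial (derive_mx fy) mxE.
suff H : partial i f y l 0 @[y --> x] --> partial i (fun x => f x l 0 : R^o) x.
  by apply: cvg_trans H; exact: near_eq_cvg E.
have <- := nbhs_singleton E.
apply: (@continuous_comp _ _ _ (partial i f) (fun M : 'cV[R]_n => M l 0)) => //.
exact: coord_continuous.
Qed.

(** The rows of [W] are the velocities of the first [m] coordinate lines of the chart, pulled back
    by [psi]. They provide at least [m] independent tangent directions. *)
Lemma submanifold_tangent m S p : C2_submanifold m S -> S p ->
  exists2 W : 'M[R]_(m, d), row_free W & forall j, tangent_space S p (row j W)^T.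
Proof.
move=> [md chart] /[dup] Sp /chart[U [V [phi [psi [[Uo Vo Up [phiC1 _] [psiC1 _]] [UV VU US]]]]]].
pose e (j : 'I_m) : 'cV[R]_d := delta_mx (widen_ord md j) 0.
pose g j (t : R) := psi (phi p + t *: e j).
have [Vp psiphi] := UV p Up.
have nearV j : exists2 eps, 0 < eps & forall t, `|t| < eps -> V (phi p + t *: e j).
  have : nbhs (phi p + 0 *: e j) V by rewrite scale0r addr0; exact: open_nbhs_nbhs.
  move=> /(@cvg_line (phi p) (e j))/nbhs_ballP[r r0 rV]; exists r => // t tr.
  by apply: rV; rewrite -ball_normE /= sub0r normrN.
have dg j (t : R) : V (phi p + t *: e j) ->
    is_derive t 1 (g j) (partial (widen_ord md j) psi (phi p + t *: e j)).
  by move=> Vt; apply: is_derive_line; have [] := psiC1 _ Vt (widen_ord md j).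
pose W : 'M[R]_(m, d) := \matrix_(j, l) partial (widen_ord md j) psi (phi p) l 0.
have rowW j : (row j W)^T = derive1 (g j) 0.
  rewrite derive1E; have [|_ ->] := dg j 0; first by rewrite scale0r addr0.
  by apply/colP => l; rewrite !mxE scale0r addr0.
exists W => [|j]; last first.
  have [eps eps0 Veps] := nearV j.
  exists (g j), eps; split=> // [|t /Veps Vt]; first by rewrite /g scale0r addr0.
  split.
  - have [Ut phit] := VU _ Vt; apply/US => // i mi.
    rewrite /g phit !mxE (US p Up).1// (_ : i == _ = false) ?mulr0 ?addr0//.
    by apply/eqP => /(congr1 val)/= ij; move: mi; rewrite ij leqNgt ltn_ord.
  - by have [] := dg j t Vt.
  - have E : \forall s \near t, partial (widen_ord md j) psi (phi p + s *: e j) = derive1 (g j) s.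
      have : nbhs (phi p + t *: e j) V by exact: open_nbhs_nbhs.
      move=> /(@cvg_line (phi p) (e j)).
      apply: (@filterS _ _ (nbhs_filter t)) => s Vs.
      by rewrite derive1E; have [_ ->] := dg j s Vs.
    suff H : partial (widen_ord md j) psi (phi p + s *: e j) @[s --> t] --> derive1 (g j) t.
      by apply: cvg_trans H; exact: near_eq_cvg E.
    have <- := nbhs_singleton E.
    have [_ psic] := psiC1 _ Vt (widen_ord md j).
    exact: (@cvg_comp _ _ _ _ _ _ _ _ (@cvg_line (phi p) (e j) t) psic).
apply/row_freeP.
(* The right inverse of [W] holds the differentials at [p] of the first [m] coordinates of [phi]:
   the chain rule is applied to [phi \o g j], near 0 a straight line with velocity [e j]. *)
exists (\matrix_(l, i) partial l (fun x => phi x (widen_ord md i) 0 : R^o) p).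
apply/matrixP => j i; rewrite !mxE.
have g0 : g j 0 = p by rewrite /g scale0r addr0.
have dphi : differentiable (fun x => phi x (widen_ord md i) 0 : R^o) (g j 0).
  by rewrite g0; apply: (C1_differentiable Uo (C1_on_coord _ Uo phiC1) Up).
have dg0 : derivable (g j) 0 1.
  by have [|] := dg j 0 => //; rewrite scale0r addr0.
have := derive_curve dg0 dphi; rewrite -rowW g0.
pose i' := widen_ord md i; pose c : R := (i == j :> nat)%:R.
have [eps eps0 Veps] := nearV j.
have z : \forall t \near (0 : R), ((fun x => phi x i' 0 : R^o) \o g j) t
    = (cst (phi p i' 0) + c *: id) t.
  have : \forall t \near (0 : R), `|t| < eps by exact: nbhs0_lt.
  apply: filterS => t /Veps/VU[_ phig] /=.
  by rewrite /g phig !mxE eqxx andbT -[RHS]/(phi p i' 0 + c * t) mulrC.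
have dh : is_derive (0 : R) 1 (cst (phi p i' 0) + c *: id : R -> R^o) c.
  by apply: is_derive_eq; rewrite add0r [LHS]mulr1.
move/@derive_val; rewrite (near_eq_derive _ z) (@derive_val _ _ _ _ _ _ _ dh).
rewrite /c (inj_eq (@ord_inj _)) eq_sym => cE.
have -> : (j == i)%:R = \sum_l (row j W)^T l 0 * (partial l (fun x => phi x i' 0 : R^o) p : R).
  exact: cE.
by apply: eq_bigr => l _; rewrite [in LHS]mxE [in RHS]mxE [in RHS]mxE [in LHS]mxE [in RHS]mxE.
Qed.

End Geometry.

(** * Taylor bound and perturbation of eigenspaces *)

Lemma dotv_row_comb {R : realType} {m d : nat} (W : 'M[R]_(m, d)) (a : 'rV[R]_m)
    (x : 'cV[R]_d) :
  dotv x (a *m W)^T = \sum_j a 0 j * dotv x (row j W)^T.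
Proof.
have -> : (a *m W)^T = \sum_j a 0 j *: (row j W)^T.
  by rewrite mulmx_sum_row linear_sum; apply: eq_bigr => j _; rewrite linearZ.
by rewrite dotv_sumr; apply: eq_bigr => j _; rewrite dotvZr.
Qed.

(** Pairing the gradient with the fixed error vector [e] gives a scalar function on the segment, so
    the mean value theorem applies: for one [c] the squared norm of [e] is [dotv e ((hess E (p + c
    *: z) - hess E x) *m z)], and a factor [norm2 e] cancels. *)
Lemma grad_taylor {R : realType} {d : nat} (E : 'cV[R]_d -> R) (p x : 'cV[R]_d) (K : R) :
  C2_on setT (E : _ -> R^o) -> grad E p = 0 ->
  (forall c, 0 <= c <= 1 -> specnorm (hess E (p + c *: (x - p)) - hess E x) <= K) ->
  norm2 (grad E x - hess E x *m (x - p)) <= K * norm2 (x - p).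
Proof.
move=> [_ E2] gp HK; set z := x - p; set e := grad E x - _.
have dE i y : differentiable (partial i (E : _ -> R^o)) y.
  exact: (C1_differentiable openT (E2 i)).
pose F : 'cV[R]_d -> R^o := \sum_i (e i 0 *: partial i (E : _ -> R^o)).
have FE y : F y = dotv e (grad E y) :> R.
  rewrite /F fct_sumE.
  transitivity (\sum_i e i 0 * (partial i (E : _ -> R^o) y : R)) => //.
  by apply: eq_bigr => i _; rewrite [grad _ _ _ _]mxE.
have dF y : is_derive y z F (dotv e (hess E y *m z)).
  have dEz i : is_derive y z (e i 0 *: partial i (E : _ -> R^o))
      (e i 0 *: 'D_z (partial i (E : _ -> R^o)) y).
    by apply: is_deriveZ; apply: derivableP; apply: diff_derivable.
  apply: (is_derive_eq (is_derive_sum dEz)).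
  transitivity (\sum_i e i 0 * ('D_z (partial i (E : _ -> R^o)) y : R)) => //.
  apply: eq_bigr => i _; rewrite derive_partial// [(_ *m _) _ _]mxE; congr (_ * _).
  transitivity (\sum_j z j 0 * (partial j (partial i (E : _ -> R^o)) y : R)) => //.
  by apply: eq_bigr => j _; rewrite [hess _ _ _ _]mxE mulrC.
have [c _|c c01] := @MVT_line _ _ F p z 1; first by have [] := dF (p + (c * 1) *: z).
have [_ ->] := dF (p + (c * 1) *: z).
have pz : p + z = x by rewrite addrC subrK.
rewrite scale1r pz mulr1 mul1r !FE gp dotv0 subr0 => eg.
have {eg} : dotv e e = dotv e ((hess E (p + c *: z) - hess E x) *m z).
  by rewrite {2}/e dotvBr eg mulmxBl dotvBr.
rewrite -norm2_sqr => eE.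
have [->|e0] := eqVneq (norm2 e) 0.
  (* If [e] vanishes it remains to see [0 <= K]: [K] bounds a spectral norm, which is a supremum
     over a set containing 0. *)
  rewrite mulr_ge0 ?norm2_ge0//; apply: le_trans (HK 0 _); last by rewrite lexx ler01.
  apply: ub_le_sup; last by exists 0; rewrite /= ?mulmx0 ?norm20.
  by have [C AC] := norm2_mulmx_bounded (hess E (p + 0 *: (x - p)) - hess E x);
    exists C => _ [y /= /AC + <-].
rewrite -(@ler_pM2l _ (norm2 e)) ?lt_def ?e0 ?norm2_ge0// -expr2 eE.
apply: le_trans (dotv_le _ _) _; rewrite ler_wpM2l ?norm2_ge0//.
apply: le_trans (norm2_mulmx_le _ _) _; rewrite ler_wpM2r ?norm2_ge0//.
exact: HK.
Qed.

Section EigenSpaces.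
Context {R : realType} {d : nat}.
Variables (H : 'M[R]_d) (u : 'I_d -> 'cV[R]_d) (lam : 'I_d -> R).
Hypothesis u_orth : orthonormal_family u.
Hypothesis u_eig : forall i, H *m u i = lam i *: u i.
Implicit Types (x y z : 'cV[R]_d) (P : pred 'I_d).

Lemma dotv_eig x i : dotv (u i) (H *m x) = lam i * dotv (u i) x.
Proof.
rewrite {1}(orthonormal_expand u_orth x) mulmx_sumr dotv_sumr (bigD1 i)//= big1.
  by rewrite addr0 -scalemxAr u_eig !dotvZr u_orth eqxx mulr1 mulrC.
by move=> j ji; rewrite -scalemxAr u_eig !dotvZr u_orth eq_sym (negbTE ji) !mulr0.
Qed.

Variables (s m : nat) (W : 'M[R]_(m, d)) (mu b : R).
Let mid : pred 'I_d := fun i => (s <= i < s + m)%N.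
Hypothesis W_free : row_free W.
Hypothesis mu_gt0 : 0 < mu.
Hypothesis b_ge0 : 0 <= b.
Hypothesis b_le : 4 * b <= mu.
Hypothesis lam_outer : forall i, ~~ mid i -> mu <= `|lam i|.
Hypothesis W_almost_ker : forall a : 'rV[R]_m,
  norm2 (H *m (a *m W)^T) <= b * norm2 (a *m W)^T.

(** [H] scales each outer coordinate by at least [mu] in absolute value, so a vector almost killed
    by [H] has a small outer part. *)
Let outer_le (a : 'rV[R]_m) :
  mu * norm2 (coord_proj u (predC mid) (a *m W)^T) <= b * norm2 (a *m W)^T.
Proof.
apply: le_trans (W_almost_ker a); rewrite -ler_pdivlMl//.
apply: (norm2_le_coord u_orth) => [|i]; first by rewrite invr_ge0 ltW.
rewrite dotv_coord_proj// dotv_eig normrM mulrA /=.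
case: ifP => mi; last by rewrite normr0 !mulr_ge0// invr_ge0 ltW.
by rewrite ler_peMl// -ler_pdivrMl ?invr_gt0// invrK mulr1 lam_outer.
Qed.

(** With [4 * b <= mu] the outer part is at most a quarter of the vector, so the triangle inequality
    leaves three quarters for the middle part; the factors 4/3 below come from here. *)
Let mid_le (a : 'rV[R]_m) :
  3 * norm2 (a *m W)^T <= 4 * norm2 (coord_proj u mid (a *m W)^T).
Proof.
have := norm2D (coord_proj u mid (a *m W)^T) (coord_proj u (predC mid) (a *m W)^T).
rewrite coord_projC//; have := outer_le a; have := norm2_ge0 (a *m W)^T.
set n := norm2 _; set o := norm2 (coord_proj _ (predC _) _) => n0 ob.
have : 4 * o <= n.
  by rewrite -(ler_pM2l mu_gt0) mulrCA (le_trans (ler_wpM2l _ ob))// mulrA ler_wpM2r.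
by lra.
Qed.

(* The rows of [W] and the [m] middle coordinates are equally many, and
   [mid_le] makes the projection injective, hence onto. *)
Lemma mid_proj_onto z : exists a : 'rV[R]_m,
  coord_proj u mid (a *m W)^T = coord_proj u mid z.
Proof.
(* When [s + i] is not below [d], [insub] fails and [e i] is 0; [projE] is unaffected, since it
   evaluates [e] only at genuine middle indices. *)
pose e (i : 'I_m) : 'cV[R]_d := if insub (s + i)%N is Some l then u l else 0.
pose G : 'M[R]_m := \matrix_(j, i) dotv (e i) (row j W)^T.
have eG (a : 'rV[R]_m) i : (a *m G) 0 i = dotv (e i) (a *m W)^T.
  by rewrite mxE dotv_row_comb; apply: eq_bigr => j _; rewrite mxE.
have projE x y : (forall i, dotv (e i) x = dotv (e i) y) ->
    coord_proj u mid x = coord_proj u mid y.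
  move=> xy; apply: eq_bigr => i /andP[si ism]; congr (_ *: _).
  have im : (i - s < m)%N by lia.
  by have := xy (Ordinal im); rewrite /e /= subnKC// valK.
have Gu : G \in unitmx.
  rewrite -row_free_unit -kermx_eq0; apply/rowV0P => a /sub_kermxP aG.
  have p0 : coord_proj u mid (a *m W)^T = 0.
    rewrite -[RHS](_ : coord_proj u mid 0 = 0).
      by apply: projE => i; rewrite -eG aG mxE dotv0.
    by rewrite /coord_proj big1// => i _; rewrite dotv0 scale0r.
  have := mid_le a; rewrite p0 norm20 mulr0 => n0.
  have /norm2_eq0/(congr1 trmx) : norm2 (a *m W)^T = 0.
    by apply/eqP; rewrite eq_le norm2_ge0 andbT; lra.
  rewrite trmxK trmx0 => aW; apply: (row_free_inj W_free).
  by rewrite mul0mx.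
exists ((\row_i dotv (e i) z) *m invmx G); apply: projE => i.
by rewrite -eG mulmxKV// mxE.
Qed.

(** Take [w] in the row space of [W] with the same middle part [y] as [z]. As [w] is orthogonal to
    [z], the squared norm of [y] is [dotv (y - w) z], and [y - w] is minus the small outer part of
    [w]. Moreover [H *m y] is the middle part of [H *m w], hence no longer than it. *)
Lemma mid_proj_small z : (forall j, dotv (row j W)^T z = 0) ->
  let y := coord_proj u mid z in
  3 * (mu * norm2 y) <= 4 * (b * norm2 z) /\
  3 * norm2 (H *m y) <= 4 * (b * norm2 y).
Proof.
move=> Wz y; have [a ay] := mid_proj_onto z.
have wz : dotv (a *m W)^T z = 0.
  by rewrite dotvC dotv_row_comb big1// => j _; rewrite dotvC Wz mulr0.
have y3 := mid_le a; rewrite ay -/y in y3.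
split.
  have [->|y0] := eqVneq (norm2 y) 0; first by rewrite !mulr0 !mulr_ge0 ?norm2_ge0.
  have ypos : 0 < norm2 y by rewrite lt_def y0 norm2_ge0.
  have yz : norm2 y ^+ 2 = dotv (- coord_proj u (predC mid) (a *m W)^T) z.
    have -> : - coord_proj u (predC mid) (a *m W)^T = y - (a *m W)^T.
      by rewrite -{2}(coord_projC u_orth mid (a *m W)^T) ay opprD addNKr.
    rewrite dotvBl wz subr0 norm2_sqr !(dotv_coord u_orth y); apply: eq_bigr => i _.
    by rewrite dotv_coord_proj//; case: ifP; rewrite ?mul0r.
  rewrite -(ler_pM2r ypos).
  have := dotv_le (- coord_proj u (predC mid) (a *m W)^T) z.
  rewrite -yz norm2N => yo.
  have := outer_le a.
  have := norm2_ge0 z; have := norm2_ge0 (a *m W)^T.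
  move: yo y3.
  set o := norm2 (coord_proj _ (predC _) _); set n := norm2 (_ *m _)^T.
  set r := norm2 z; set t := norm2 y => yo y3 n0 r0 ob.
  have h1 : mu * t ^+ 2 <= b * n * r.
    apply: le_trans (_ : mu * (o * r) <= _); first by rewrite ler_wpM2l ?(ltW mu_gt0).
    by rewrite mulrA ler_wpM2r.
  have h2 : b * r * (3 * n) <= b * r * (4 * t) by rewrite ler_wpM2l ?mulr_ge0.
  by lra.
have : norm2 (H *m y) <= norm2 (H *m (a *m W)^T).
  rewrite -[leRHS]mul1r; apply: (norm2_le_coord u_orth) => // i.
  rewrite !dotv_eig mul1r /y -ay dotv_coord_proj//.
  by case: ifP => // _; rewrite mulr0 normr0.
move=> /le_trans/(_ (W_almost_ker a)) h.
have := ler_wpM2l b_ge0 y3; lra.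
Qed.

End EigenSpaces.

(** * One Euler step *)

Section Reflection.
Context {R : realType} {d k : nat} (v : 'I_k -> 'cV[R]_d).
Hypothesis v_orth : orthonormal_family v.

Let Q : 'M[R]_d := 1%:M - 2 *: \sum_(p < k) v p *m (v p)^T.

Lemma reflectionE x : Q *m x = x - 2 *: \sum_(p < k) dotv (v p) x *: v p.
Proof.
rewrite mulmxBl mul1mx -scalemxAl mulmx_suml; congr (_ - _ *: _).
apply: eq_bigr => p _; rewrite -mulmxA dotv_mulmx.
by rewrite [X in v p *m X]mx11_scalar mul_mx_scalar.
Qed.

(** With [y] the projection of [x] on the span of the [v p], [dotv y y = dotv x y], so the extra
    terms cancel in the squared norm of [x - 2 *: y]. *)
Lemma norm2_reflection x : norm2 (Q *m x) = norm2 x.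
Proof.
rewrite /norm2 reflectionE; congr Num.sqrt.
set y := \sum_(p < k) _.
have vy p : dotv (v p) y = dotv (v p) x.
  rewrite dotv_sumr (bigD1 p)//= dotvZr v_orth eqxx mulr1 big1 ?addr0// => l lp.
  by rewrite dotvZr v_orth eq_sym (negbTE lp) mulr0.
have yx : dotv y y = dotv x y.
  rewrite /y [in LHS]dotv_sumr [in RHS]dotv_sumr -/y; apply: eq_bigr => p _.
  by rewrite !dotvZr (dotvC y) (dotvC x) vy.
by rewrite dotvBl !dotvBr !dotvZl !dotvZr (dotvC y x) yx; ring.
Qed.

Lemma reflection_self p : Q *m v p = - v p.
Proof.
rewrite reflectionE (bigD1 p)//= v_orth eqxx scale1r big1 => [|l lp].
  by rewrite addr0 scaler_nat mulr2n opprD addNKr.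
by rewrite v_orth (negbTE lp) scale0r.
Qed.

Lemma reflection_orth x : (forall p, dotv (v p) x = 0) -> Q *m x = x.
Proof.
by move=> vx; rewrite reflectionE big1 ?scaler0 ?subr0// => p _; rewrite vx scale0r.
Qed.

End Reflection.

(** Serves for the vectors [v t p] with [s <= p], which are chosen freely in the middle eigenspace
    yet are orthogonal to every outer eigenvector. *)
Lemma orthonormal_span0 {R : realType} {d : nat} (u : 'I_d -> 'cV[R]_d) (P : pred 'I_d)
    i x : orthonormal_family u -> ~~ P i ->
  x \in <<[seq u j | j : 'I_d <- enum 'I_d & P j]>>%VS -> dotv x (u i) = 0.
Proof.
move=> u_orth Pi; set X := [seq _ | _ <- _ & _] => xX.
rewrite (coord_span (X := in_tuple X) xX) dotvC dotv_sumr big1// => l _.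
rewrite dotvZr /=.
have /mapP[j] : X`_l \in X by rewrite mem_nth// ltn_ord.
rewrite mem_filter => /andP[Pj _] ->; rewrite u_orth.
by case: eqP Pi => [->|_ _]; [rewrite Pj|rewrite mulr0].
Qed.

Section Step.
Context {R : realType} {d : nat}.
Variables (H Q : 'M[R]_d) (u : 'I_d -> 'cV[R]_d) (lam : 'I_d -> R) (mid : pred 'I_d).
Variables (L mu beta b : R) (z g : 'cV[R]_d).
Hypothesis u_orth : orthonormal_family u.
Hypothesis u_eig : forall i, H *m u i = lam i *: u i.
Hypothesis Q_isom : forall x, norm2 (Q *m x) = norm2 x.
Hypothesis Q_outer : forall i, ~~ mid i -> Q *m u i = Num.sg (lam i) *: u i.
Hypothesis lam_outer : forall i, ~~ mid i -> mu <= `|lam i| <= L.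
Hypothesis mu_gt0 : 0 < mu.
Hypothesis L_gt0 : 0 < L.
Hypothesis beta_range : 0 < beta <= 2 / (L + mu).
Hypothesis b_ge0 : 0 <= b.
Hypothesis b_le : 4 * b <= mu.
Let y := coord_proj u mid z.
Hypothesis y_small : 3 * (mu * norm2 y) <= 4 * (b * norm2 z).
Hypothesis Hy_small : 3 * norm2 (H *m y) <= 4 * (b * norm2 y).
Hypothesis g_near : norm2 (g - H *m z) <= b * norm2 z.

(** Outer coordinate [i] is multiplied by 1 minus [beta] times the absolute value of [lam i]. The
    bound [beta * (L + mu) <= 2] keeps this factor above [- (1 - mu * beta)] even for eigenvalues of
    size [L]. *)
Let outer_step :
  norm2 (coord_proj u (predC mid) z
         - beta *: (Q *m (H *m coord_proj u (predC mid) z)))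
  <= (1 - mu * beta) * norm2 z.
Proof.
set x := coord_proj u (predC mid) z; have [beta0 betaL] := andP beta_range.
(* Without outer indices no eigenvalue yields [mu <= L], and [1 - mu * beta] might be negative; but
   then [y = z], and [y_small] with [b_le] forces [z = 0]. *)
have [i0 mi0|nomid] := pickP (predC mid); last first.
  have x0 : x = 0 by rewrite /x /coord_proj big1// => i; rewrite nomid.
  have yz : y = z by rewrite -[RHS](coord_projC u_orth mid z) -/x x0 addr0.
  have -> : z = 0.
    apply: norm2_eq0; apply/eqP; rewrite eq_le norm2_ge0 andbT.
    have := y_small; rewrite yz; have := ler_wpM2r (norm2_ge0 z) b_le.
    have := norm2_ge0 z => z0 h1 h2.
    by rewrite -(pmulr_rle0 _ mu_gt0); lra.
  by rewrite x0 !mulmx0 scaler0 subr0 norm20 mulr0.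
have muL : mu <= L by have /andP[] := lam_outer mi0; apply: le_trans.
have {betaL} betaL : beta * (L + mu) <= 2 by rewrite -ler_pdivlMr// addr_gt0.
have mubeta : beta * mu <= beta * L by rewrite ler_wpM2l// ltW.
have QHx : Q *m (H *m x) = \sum_(i | predC mid i) (`|lam i| * dotv (u i) z) *: u i.
  rewrite /x /coord_proj !mulmx_sumr; apply: eq_bigr => i mi.
  rewrite -!scalemxAr u_eig -scalemxAr Q_outer// !scalerA; congr (_ *: _).
  by rewrite [in RHS]normrEsg; ring.
apply: (norm2_le_coord u_orth) => [|i]; first by lra.
rewrite QHx dotvBr dotvZr dotv_coord_proj// dotv_comb//.
case: ifP => mi; last by rewrite mulr0 subr0 normr0 mulr_ge0//; lra.
set c := dotv (u i) z.
have -> : c - beta * (`|lam i| * c) = (1 - beta * `|lam i|) * c by ring.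
rewrite normrM ler_wpM2r//.
have /andP[l1 l2] := lam_outer mi.
have := ler_wpM2l (ltW beta0) l1; have := ler_wpM2l (ltW beta0) l2.
by rewrite ler_norml => h1 h2; apply/andP; split; lra.
Qed.

(** To the contracted outer part are added the errors [y], [beta] times [H *m y] and [beta] times
    the Taylor remainder, [Q] being an isometry. In units of [b * norm2 z] they are at most
    [4 / 3 / mu], [4 / 3 * beta] and [beta], rounded up to [2 / mu + 5 / 2 * beta]. *)
Lemma step_le : norm2 (z - beta *: (Q *m g)) <=
  (1 - mu * beta) * norm2 z + (2 / mu + 5 / 2 * beta) * b * norm2 z.
Proof.
have [beta0 _] := andP beta_range.
set x := coord_proj u (predC mid) z.
have zE : z - beta *: (Q *m g) = (x - beta *: (Q *m (H *m x))) +
    (y - beta *: (Q *m (H *m y)) - beta *: (Q *m (g - H *m z))).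
  rewrite -{1 2}(coord_projC u_orth mid z) -/x -/y mulmxBr.
  rewrite (mulmxDr H) (mulmxDr Q) scalerBr !scalerDr.
  move: (Q *m (H *m x)) (Q *m (H *m y)) (Q *m g) => a1 a2 a3.
  by apply/colP => i; rewrite !mxE; ring.
rewrite zE; apply: le_trans (norm2D _ _) _; apply: lerD; first exact: outer_step.
apply: le_trans (norm2D _ _) _; rewrite norm2N.
apply: le_trans (lerD (norm2D _ _) (lexx _)) _; rewrite norm2N.
rewrite !norm2Z !Q_isom gtr0_norm//.
have yz : norm2 y <= norm2 z by exact: norm2_coord_proj.
have h1 : norm2 y <= 4 / 3 * (b * norm2 z) / mu.
  by rewrite ler_pdivlMr//; have := y_small; lra.
have h2 : beta * norm2 (H *m y) <= beta * (4 / 3 * (b * norm2 z)).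
  rewrite ler_wpM2l ?(ltW beta0)//.
  by have := ler_wpM2l b_ge0 yz; have := Hy_small; lra.
have h3 : beta * norm2 (g - H *m z) <= beta * (b * norm2 z).
  by rewrite ler_wpM2l ?(ltW beta0).
have bz : 0 <= b * norm2 z by rewrite mulr_ge0 ?norm2_ge0.
have bz1 : 0 <= beta * (b * norm2 z) by rewrite mulr_ge0 ?(ltW beta0).
have bz2 : 0 <= (b * norm2 z) / mu by rewrite divr_ge0 ?(ltW mu_gt0).
have -> : (2 / mu + 5 / 2 * beta) * b * norm2 z =
  2 * (b * norm2 z / mu) + 5 / 2 * (beta * (b * norm2 z)) by ring.
have {}h1 : norm2 y <= 4 / 3 * (b * norm2 z / mu) by rewrite mulrA.
lra.
Qed.

End Step.

(** * Scalar recursion and convergence of the iterates *)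

(** Multiplied by [rho], the hypothesis reads [rho * r' <= rho * r - q * r * (rho - r)]. Since
    [r' <= r], the subtracted term may be lowered to [q * r' * (rho - r)], and rearranging gives the
    ratio bound. *)
Lemma perturbed_contraction {R : realType} (q rho r r' : R) :
  0 < q -> 0 <= r < rho -> 0 <= r' <= (1 - q) * r + q / rho * r ^+ 2 ->
  [/\ r' <= r, 0 < r -> r' < r &
      r' / (rho - r') <= (1 + q)^-1 * (r / (rho - r))].
Proof.
move=> q0 /andP[r0 rrho] /andP[r'0 r'le].
have rho0 : 0 < rho by apply: le_lt_trans rrho.
have E : (1 - q) * r + q / rho * r ^+ 2 = r - q * r * (1 - r / rho) by field; lra.
have s0 : 0 < 1 - r / rho by rewrite subr_gt0 ltr_pdivrMr// mul1r.
rewrite {}E in r'le.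
have r'r : r' <= r.
  by apply: le_trans r'le _; rewrite gerBl !mulr_ge0// ltW.
split=> // [rpos|].
  by apply: le_lt_trans r'le _; rewrite gtrBl !mulr_gt0.
have q1 : 0 < 1 + q by rewrite addr_gt0.
have -> : (1 + q)^-1 * (r / (rho - r)) = r / ((1 + q) * (rho - r)).
  by field; rewrite !lt0r_neq0//; lra.
rewrite ler_pdivrMr; last by lra.
rewrite mulrAC ler_pdivlMr; last by rewrite mulr_gt0//; lra.
have h : rho * r' <= rho * r - q * r * (rho - r).
  have -> : rho * r - q * r * (rho - r) = rho * (r - q * r * (1 - r / rho)).
    by field; lra.
  by rewrite ler_wpM2l// ltW.
have : q * r' * (rho - r) <= q * r * (rho - r).
  by rewrite ler_wpM2r ?subr_ge0 ?(ltW rrho)// ler_wpM2l ?(ltW q0).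
lra.
Qed.

Lemma normr_itv {R : realDomainType} (x a b : R) :
  0 < a -> (- b <= x <= - a) \/ (a <= x <= b) -> a <= `|x| <= b.
Proof.
move=> a0 [] /andP[x1 x2]; first by rewrite ler0_norm; lra.
by rewrite ger0_norm; lra.
Qed.

Theorem theorem3p15 (R : realType) (d m s k : nat)
  (E : 'cV[R]_d -> R) (Mfd : set 'cV[R]_d) (delta M L mu beta : R)
  (theta : nat -> 'cV[R]_d)
  (u : nat -> 'I_d -> 'cV[R]_d) (v : nat -> 'I_k -> 'cV[R]_d)
  (E_C2 : C2_on setT (E : _ -> R^o))
  (hess_bounded : exists B : R, forall x, specnorm (hess E x) <= B)
  (Mfd_crit : nondegenerate_critical_manifold E Mfd m s)
  (delta_gt0 : 0 < delta) (M_gt0 : 0 < M) (L_gt0 : 0 < L) (mu_gt0 : 0 < mu)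
  (M_delta : M * delta <= mu / 4)
  (proj_wd : forall x, tube Mfd delta x -> exists! p, is_nearest Mfd x p)
  (hess_lip : forall x y, tube Mfd delta x -> tube Mfd delta y ->
    specnorm (hess E x - hess E y) <= M * norm2 (x - y))
  (eig_neg : forall x, tube Mfd delta x -> forall i : 'I_d, (i < s)%N ->
    - L <= eigvals (hess E x) 0 i <= - mu)
  (eig_pos : forall x, tube Mfd delta x -> forall i : 'I_d, (s + m <= i)%N ->
    mu <= eigvals (hess E x) 0 i <= L)
  (k_range : (s <= k <= s + m)%N)
  (u_eig : forall t, ordered_eigenbasis (hess E (theta t)) (u t))
  (v_orth : forall t, orthonormal_family (v t))
  (v_low : forall t (p : 'I_k) (i : 'I_d),
    (p < s)%N -> p = i :> nat -> v t p = u t i)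
  (v_mid : forall t (p : 'I_k), (s <= p)%N ->
    v t p \in <<[seq u t i | i : 'I_d <- enum 'I_d & (s <= i < s + m)%N]>>%VS)
  (euler : forall t, theta t.+1 =
    theta t - beta *: ((1%:M - 2 *: \sum_(p < k) v t p *m (v t p)^T)
                         *m grad E (theta t)))
  (beta_range : 0 < beta <= 2 / (L + mu)) :
  let rhat := 2 * mu ^+ 2 * beta / ((5 * mu * beta + 4) * M) in
  let r := fun t => norm2 (theta t - nearest_proj Mfd (theta t)) in
  tube Mfd delta (theta 0%N) ->
  r 0%N < rhat ->
  [/\ forall t, r t.+1 <= r t /\ (0 < r t -> r t.+1 < r t),
      r @ \oo --> 0 &
      forall t, r t <= (1 + mu * beta) ^- t * (rhat * r 0%N / (rhat - r 0%N))].
Proof.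
move=> rhat r T0 r0rhat.
have [Mfd_closed _ Mfd_sub Mfd_pt] := Mfd_crit.
have [p0 [[Mp0 _] _]] := proj_wd _ T0.
(* A nearest point is required for every [x], since the next iterate is not known to lie in the tube
   when its distance is estimated. *)
have nearP x : is_nearest Mfd x (nearest_proj Mfd x).
  have [q qP] := nearest_exists x Mfd_closed (ex_intro _ p0 Mp0).
  exact: (xgetPex 0 (ex_intro _ q qP)).
have dist_le x q : Mfd q -> norm2 (x - nearest_proj Mfd x) <= norm2 (x - q).
  by move=> Mq; have [_] := nearP x; apply.
have [beta0 _] := andP beta_range.
have step t : tube Mfd delta (theta t) ->
    r t.+1 <= (1 - mu * beta) * r t + (2 / mu + 5 / 2 * beta) * M * r t ^+ 2.
  move=> Tt; set x := theta t; set p := nearest_proj Mfd x; set z := x - p.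
  have [Mp pmin] := nearP x.
  have [gp _ _] := Mfd_pt p Mp.
  have rE : r t = norm2 z by [].
  have zdelta : norm2 z < delta by exact: Tt.
  (* The distance from [p + c *: z] to the manifold is at most its distance to [p], so the segment
     over which the gradient is expanded lies in the tube and [hess_lip] applies along it. *)
  have tube_seg c : 0 <= c <= 1 -> tube Mfd delta (p + c *: z).
    move=> /andP[c0 c1]; apply: le_lt_trans (dist_le _ _ Mp) _.
    rewrite addrAC subrr add0r norm2Z ger0_norm// (le_lt_trans _ zdelta)//.
    by rewrite ler_piMl ?norm2_ge0.
  have Tp : tube Mfd delta p.
    by have := tube_seg 0; rewrite scale0r addr0; apply; rewrite lexx ler01.
  have [W W_free W_tan] := submanifold_tangent Mfd_sub Mp.
  have b0 : 0 <= M * norm2 z by rewrite mulr_ge0 ?norm2_ge0 ?(ltW M_gt0).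
  have b_le : 4 * (M * norm2 z) <= mu.
    have := le_trans (ler_wpM2l (ltW M_gt0) (ltW zdelta)) M_delta.
    by rewrite ler_pdivlMr// mulrC.
  pose H := hess E x; pose lam i := eigvals H 0 i.
  pose mid : pred 'I_d := fun i => (s <= i < s + m)%N.
  have [u_orth u_eigen] := u_eig t.
  have outer i : ~~ mid i -> (i < s)%N \/ (s + m <= i)%N by rewrite /mid negb_and -ltnNge -leqNgt => /orP.
  have lam_outer i : ~~ mid i -> mu <= `|lam i| <= L.
    move=> /outer[/(eig_neg _ Tt)|/(eig_pos _ Tt)] lami; apply: normr_itv => //.
      by left.
    by right.
  have W_almost_ker (a : 'rV[R]_m) :
      norm2 (H *m (a *m W)^T) <= (M * norm2 z) * norm2 (a *m W)^T.
    have E0 : hess E p *m (a *m W)^T = 0.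
      apply/trmx_inj; rewrite trmx0 trmx_mul trmxK -mulmxA.
      have -> : W *m (hess E p)^T = 0.
        apply/row_matrixP => j; rewrite row_mul row0; apply/trmx_inj.
        rewrite trmx0 trmx_mul trmxK.
        apply: (hess_tangent E_C2 _ (W_tan j)) => q /Mfd_pt[] //.
      by rewrite mulmx0.
    rewrite -[X in norm2 X]subr0 -E0 -mulmxBl.
    apply: le_trans (norm2_mulmx_le _ _) _; rewrite ler_wpM2r ?norm2_ge0//.
    exact: (hess_lip _ _ Tt Tp).
  have W_z j : dotv (row j W)^T z = 0 by exact: tangent_orthogonal (nearP x) (W_tan j).
  have [y1 y2] := mid_proj_small u_orth u_eigen W_free mu_gt0 b0 b_le
    (fun i mi => proj1 (andP (lam_outer i mi))) W_almost_ker W_z.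
  (* An outer index below [s] is below [k], so [u t i] is one of the [v t p] and gets flipped, its
     eigenvalue being negative; for an index from [s + m] on, [u t i] is orthogonal to all [v t p]
     and stays fixed. *)
  have Q_outer i : ~~ mid i ->
      (1%:M - 2 *: \sum_(p < k) v t p *m (v t p)^T) *m u t i = Num.sg (lam i) *: u t i.
    have [sk km] := andP k_range.
    move=> mi; case: (outer i mi) => si.
      have ik : (i < k)%N := leq_trans si sk.
      have vu := v_low t (Ordinal ik) i si erefl.
      have /andP[_ lmu] := eig_neg _ Tt _ si.
      rewrite -vu reflection_self// ltr0_sg ?scaleN1r//.
      by rewrite (le_lt_trans lmu)// oppr_lt0.
    have /andP[lmu _] := eig_pos _ Tt _ si.
    rewrite gtr0_sg ?scale1r ?(lt_le_trans mu_gt0 lmu)//.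
    apply: reflection_orth => // l; have [ls|sl] := ltnP l s.
      have li : (l < i)%N := leq_trans ls (leq_trans (leq_addr m s) si).
      have ld : (l < d)%N := ltn_trans li (ltn_ord i).
      rewrite (v_low t l (Ordinal ld))// u_orth.
      by rewrite -val_eqE /= ltn_eqF.
    by apply: (orthonormal_span0 u_orth mi); exact: v_mid.
  have g_near : norm2 (grad E x - H *m z) <= (M * norm2 z) * norm2 z.
    apply: (grad_taylor E_C2 gp) => c c01.
    apply: le_trans (hess_lip _ _ (tube_seg c c01) Tt) _.
    rewrite -/x -/z; have -> : p + c *: z - x = (c - 1) *: z.
      by rewrite scalerBl scale1r {3}/z opprB addrCA addrA.
    rewrite norm2Z ler_wpM2l ?(ltW M_gt0)// ler_piMl ?norm2_ge0//.
    have /andP[c0 c1] := c01.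
    by rewrite ler0_norm ?subr_le0// opprB lerBlDl lerDr.
  have := step_le u_orth u_eigen (norm2_reflection (v_orth t)) Q_outer lam_outer
    mu_gt0 L_gt0 beta_range b0 b_le y1 y2 g_near.
  rewrite rE expr2 !mulrA; apply: le_trans.
  (* The old projection [p] bounds the new distance from above, so the new projection needs no
     tracking. *)
  rewrite /r euler; apply: le_trans (dist_le _ _ Mp) _.
  by rewrite /z addrAC.
pose q := mu * beta.
have q0 : 0 < q by rewrite mulr_gt0.
have rhat0 : 0 < rhat.
  by rewrite divr_gt0 ?mulr_gt0 ?exprn_gt0// addr_gt0// ?mulr_gt0.
(* [rhat] is the radius at which the quadratic error equals the linear gain [q * r]. *)
have qrhat : (2 / mu + 5 / 2 * beta) * M = q / rhat.
  have D0 : 0 < 5 * mu * beta + 4 by rewrite addr_gt0// ?mulr_gt0.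
  by rewrite /rhat /q; field; rewrite !lt0r_neq0.
have r_ge0 t : 0 <= r t by exact: norm2_ge0.
have contraction t : tube Mfd delta (theta t) -> r t < rhat ->
    [/\ r t.+1 <= r t, 0 < r t -> r t.+1 < r t &
        r t.+1 / (rhat - r t.+1) <= (1 + q)^-1 * (r t / (rhat - r t))].
  move=> Tt rt; apply: perturbed_contraction => //; first by rewrite r_ge0.
  by rewrite r_ge0 -qrhat step.
(* The distance never increases, so membership in the tube and the bound by [rhat] both persist,
   whatever the order of [delta] and [rhat]. *)
have inv t : [/\ tube Mfd delta (theta t), r t < rhat &
    r t / (rhat - r t) <= (1 + q) ^- t * (r 0%N / (rhat - r 0%N))].
  elim: t => [|t [Tt rt IH]]; first by rewrite expr0 invr1 mul1r.
  have [rS _ rS'] := contraction t Tt rt; split.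
  - exact: le_lt_trans rS Tt.
  - exact: le_lt_trans rS rt.
  - apply: le_trans rS' _; rewrite exprS invfM -mulrA ler_wpM2l//.
    by rewrite invr_ge0 addr_ge0 ?ler01 ?(ltW q0).
have rate t : r t <= (1 + q) ^- t * (rhat * r 0%N / (rhat - r 0%N)).
  have [_ rt h] := inv t.
  have rt0 : 0 < rhat - r t by rewrite subr_gt0.
  apply: (@le_trans _ _ (rhat * (r t / (rhat - r t)))).
    by rewrite mulrCA ler_peMr// ler_pdivlMr// mul1r gerBl.
  by apply: le_trans (ler_wpM2l (ltW rhat0) h) _; rewrite mulrCA (mulrA rhat).
split=> //.
  by move=> t; have [Tt rt _] := inv t; have [] := contraction t Tt rt.
have q1 : `|(1 + q)^-1| < 1.
  by rewrite ger0_norm ?invf_lt1 ?invr_ge0 ?ltrDl ?addr_gt0 ?addr_ge0 ?(ltW q0).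
have cvg0 : (fun t => (1 + q) ^- t * (rhat * r 0%N / (rhat - r 0%N))) @ \oo --> (0 : R).
  set C := rhat * _ / _; rewrite -[X in _ --> X](mul0r C).
  apply: cvgM; last exact: cvg_cst.
  rewrite (_ : (fun _ => _) = (fun t => (1 + q)^-1 ^+ t)); first exact: cvg_expr.
  by apply/funext => t; rewrite exprVn.
apply: (squeeze_cvgr _ (cvg_cst 0) cvg0).
by near=> t; rewrite r_ge0 rate.
Unshelve. all: by end_near. Qed.
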